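(* Let $p\in\mathbb{N}$ and $k\in\mathbb{N}$ with $k\le p$. Consider the Banach--Lie group $G:=(L^p([0,1],\mathbb{R}),+)$ and its unitary representation $\pi$ on $\mathcal H=L^2([0,1],\mathbb{C})$ given by $\pi(g)f:=e^{ig}f$. Then $$\mathcal D_{\mathfrak g}^k=\mathcal D_{L^{p/k}}=\begin{cases}\{0\} & \text{for } k>\frac p2,\\ L^\infty([0,1],\mathbb{C}) & \text{for } k=\frac p2,\\ L^{\frac{2p}{p-2k}}([0,1],\mathbb{C}) & \text{for } k<\frac p2.\end{cases}$$
   Context: $[0,1]$ carries Lebesgue measure. The Lie algebra of $G$ is $\mathfrak g=L^p([0,1],\mathbb{R})$ with exponential function the identity. For $x\in\mathfrak g$ let $\mathcal D_x:=\{\xi\in\mathcal H:\frac{d}{dt}|_{t=0}\pi(tx)\xi\text{ exists}\}$ and $\overline{\mathrm{d}\pi}(x)\xi:=\frac{d}{dt}|_{t=0}\pi(tx)\xi$ for $\xi\in\mathcal D_x$ (this operator is multiplication by $ix$ on its domain). Put $\mathcal D_{\mathfrak g}^1:=\mathcal D_{\mathfrak g}:=\bigcap_{x\in\mathfrak g}\mathcal D_x$ and, for $n>1$, $\mathcal D_{\mathfrak g}^n:=\{\xi\in\mathcal D_{\mathfrak g}:(\forall x\in\mathfrak g)\ \overline{\mathrm{d}\pi}(x)\xi\in\mathcal D_{\mathfrak g}^{n-1}\}$. For $q\ge1$, $\mathcal D_{L^q}:=\{\xi\in\mathcal H:(\forall f\in L^q([0,1],\mathbb{R}))\ f\xi\in\mathcal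 H\}$. *)

(* Defs.v *)
From HB Require Import structures.
From mathcomp Require Import all_boot all_order all_algebra.
From mathcomp Require Import generic_quotient complex.
From mathcomp Require Import all_classical all_reals all_analysis.
From mathcomp Require Import measurable_realfun.
Set Implicit Arguments.
Unset Strict Implicit.
Unset Printing Implicit Defensive.
Import Order.TTheory GRing.Theory Num.Theory.
Import numFieldNormedType.Exports.
Local Open Scope classical_set_scope.
Local Open Scope ring_scope.
Local Open Scope complex_scope.
Local Open Scope quotient_scope.

(* C as a measurable space, with the sigma-algebra generated by the real and
   imaginary parts (this is the Borel sigma-algebra of C = R^2). *)
Definition measurableTypeC (R : realType) : Type := R[i].

Section measurableTypeC_instances.
Variable R : realType.
Local Notation C := (measurableTypeC R).

Definition ReC (z : C) : measurableTypeR R := complex.Re z.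
Definition ImC (z : C) : measurableTypeR R := complex.Im z.

HB.instance Definition _ := Choice.on C.
HB.instance Definition _ := isPointed.Build C (0 : R[i]).

Definition measurableC_sets : set (set C) := g_sigma_preimageU ReC ImC.

Let measurableC0 : measurableC_sets set0.
Proof. exact: sigma_algebra0. Qed.

Let measurable_compl A : measurableC_sets A -> measurableC_sets (~` A).
Proof. exact: sigma_algebraC. Qed.

Let measurable_countableU (F : (set C)^nat) :
  (forall k, measurableC_sets (F k)) -> measurableC_sets (\bigcup_k F k).
Proof. exact: sigma_algebra_bigcup. Qed.

HB.instance Definition _ := @isMeasurable.Build default_measure_display C
  measurableC_sets measurableC0 measurable_compl measurable_countableU.

Lemma measurable_funCP d (T : measurableType d) (f : T -> C) :
  measurable_fun setT f <->
  measurable_fun setT (ReC \o f) /\ measurable_fun setT (ImC \o f).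
Proof.
apply: (@iff_trans _ (g_sigma_preimageU (ReC \o f) (ImC \o f) `<=` measurable)).
- rewrite g_sigma_preimageU_comp; split=> [mf A [D HD <-]|f12]; first exact: mf.
  by move=> _ A mA; apply: f12; exists A.
- split => [h12|[mf1 mf2]].
    split => _ A mA; apply: h12; apply: sub_sigma_algebra;
    by [left; exists A|right; exists A].
  apply: smallest_sub; first exact: sigma_algebra_measurable.
  by rewrite subUset; split=> [|] A [D mD <-]; [exact: mf1|exact: mf2].
Qed.

End measurableTypeC_instances.

Section unit_interval.
Variable R : realType.
Local Notation TR := (measurableTypeR R).
Local Notation TC := (measurableTypeC R).

(* Functions on [0,1] are encoded as functions on the whole line taken up to
   equality almost everywhere for the Lebesgue measure restricted to [0,1];
   their values outside [0,1] are therefore irrelevant. *)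
Definition leb01 : {measure set TR -> \bar R} :=
  mrestr lebesgue_measure (measurable_itv `[0%R, 1%R]).

(* Classes of measurable real (resp. complex) functions on [0,1] modulo
   almost everywhere equality. *)
Local Notation L0R := {mfun_ leb01, TR >-> TR} (only parsing).
Local Notation L0C := {mfun_ leb01, TR >-> TC} (only parsing).

(* As for [LspaceType], the norm is computed on the canonical representative;
   it does not depend on the choice of the representative. *)
Definition LR (q : \bar R) : set L0R :=
  [set x : L0R | finite_norm leb01 q x].
Definition LC (q : \bar R) : set L0C :=
  [set xi : L0C | finite_norm leb01 q (fun s => Normc.normc (xi s : R[i]))].

Definition L2C : set L0C := LC 2%:E.

Definition expi (y : R) : R[i] := cos y +i* sin y.

Section measurable_operations.
Variables (x : {mfun TR >-> TR}) (xi : {mfun TR >-> TC}) (t : R).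

Definition scale_fun (s : TR) : TR := t * x s.
Definition mul_fun (s : TR) : TC := (x s)%:C * (xi s : R[i]).
Definition expi_fun (s : TR) : TC := expi (x s) * (xi s : R[i]).

Let mRe : measurable_fun setT (fun s => ReC (xi s)).
Proof. by have /measurable_funCP[] := @measurable_funPT _ _ _ _ xi. Qed.

Let mIm : measurable_fun setT (fun s => ImC (xi s)).
Proof. by have /measurable_funCP[] := @measurable_funPT _ _ _ _ xi. Qed.

Let mx : measurable_fun setT x.
Proof. exact: measurable_funPT. Qed.

Let mMC (u v : TR -> R) : measurable_fun setT u -> measurable_fun setT v ->
  measurable_fun setT (fun s => (u s +i* v s) * (xi s : R[i]) : TC).
Proof.
move=> mu mv; apply/measurable_funCP; split.
- rewrite (_ : _ \o _ = (fun s => u s * ReC (xi s) - v s * ImC (xi s))).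
    by apply: measurable_funB; apply: measurable_funM.
  by apply/funext => s /=; rewrite /ReC /ImC; case: (xi s : R[i]).
- rewrite (_ : _ \o _ = (fun s => u s * ImC (xi s) + v s * ReC (xi s))).
    by apply: measurable_funD; apply: measurable_funM.
  by apply/funext => s /=; rewrite /ReC /ImC; case: (xi s : R[i]).
Qed.

Lemma measurable_scale_fun : measurable_fun setT scale_fun.
Proof. by apply: measurable_funM => //; exact: measurable_cst. Qed.

Lemma measurable_mul_fun : measurable_fun setT mul_fun.
Proof. by apply: mMC => //; exact: measurable_cst. Qed.

Lemma measurable_expi_fun : measurable_fun setT expi_fun.
Proof.
apply: mMC.
- apply: (@measurableT_comp _ _ _ _ _ _ cos) => //.
  by apply: continuous_measurable_fun; exact: continuous_cos.
- apply: (@measurableT_comp _ _ _ _ _ _ sin) => //.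
  by apply: continuous_measurable_fun; exact: continuous_sin.
Qed.

HB.instance Definition _ :=
  isMeasurableFun.Build _ _ _ _ scale_fun measurable_scale_fun.
HB.instance Definition _ :=
  isMeasurableFun.Build _ _ _ _ mul_fun measurable_mul_fun.
HB.instance Definition _ :=
  isMeasurableFun.Build _ _ _ _ expi_fun measurable_expi_fun.

Definition scale_mfun : {mfun TR >-> TR} := scale_fun.
Definition mul_mfun : {mfun TR >-> TC} := mul_fun.
Definition expi_mfun : {mfun TR >-> TC} := expi_fun.

End measurable_operations.

Definition zeroC : L0C := \pi_(L0C) (cst (0 : TC) : {mfun TR >-> TC}).

Definition scaleL0 (t : R) (x : L0R) : L0R := \pi_(L0R) (scale_mfun (repr x) t).

Definition mulL0 (f : L0R) (xi : L0C) : L0C :=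
  \pi_(L0C) (mul_mfun (repr f) (repr xi)).

(* The representation pi(g) xi = e^{ig} xi. *)
Definition rep (g : L0R) (xi : L0C) : L0C :=
  \pi_(L0C) (expi_mfun (repr g) (repr xi)).

Definition diff_quot (x : L0R) (xi : L0C) (t : R) (s : TR) : R[i] :=
  t^-1%:C * ((rep (scaleL0 t x) xi s : R[i]) - (xi s : R[i])).

(* [is_drep x xi eta]: the derivative at t = 0 of t |-> pi(tx) xi exists in
   the Hilbert space and is [eta]. *)
Definition is_drep (x : L0R) (xi eta : L0C) : Prop :=
  L2C eta /\
  ('N[leb01]_2%:E [(fun s =>
     (Normc.normc (diff_quot x xi t s - (eta s : R[i])))%:E)])%E
    @[t --> (0 : R)^'] --> 0%E.

Definition D_ (x : L0R) : set L0C :=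
  [set xi : L0C | L2C xi /\ exists eta, is_drep x xi eta].

(* The derivative on [D_ x]; the value [zeroC] off [D_ x] is a dummy. *)
Definition drep (x : L0R) (xi : L0C) : L0C := xget zeroC (is_drep x xi).

Section iterated_domains.
Variable p : nat.

Definition Dg : set L0C := \bigcap_(x in LR p%:R%:E) D_ x.

(* Indexed from 1: [Dg_pow 1] is [Dg], and [Dg_pow 0] is a dummy value. *)
Definition Dg_pow (n : nat) : set L0C :=
  iter n.-1
    (fun E : set L0C =>
       [set xi : L0C | Dg xi /\ forall x, LR p%:R%:E x -> E (drep x xi)])
    Dg.

End iterated_domains.

Definition D_L (q : R) : set L0C :=
  [set xi : L0C | L2C xi /\ forall f, LR q%:E f -> L2C (mulL0 f xi)].

End unit_interval.

Arguments zeroC {R}.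

(* Main.v *)
(* Everything reduces to the multiplier condition [f * |xi|] in [L^2] for all
   [f] in [L^q].  The difference quotients of [pi(tx) xi] converge pointwise to
   [i x xi] and, up to a constant, are dominated by [x xi]; so (Fatou in one
   direction, dominated convergence in the other) [xi] lies in [D_x] exactly
   when [x xi] is in [L^2], and the derivative is [i x xi].  Since
   [L^(p/(n+1)) = L^p * L^(p/n)], induction identifies the iterated domains with
   [D_(L^(p/k))].

   A multiplier [a] from [L^q] to [L^2] satisfies, by a gliding hump argument,
   [\int |f a|^2 <= C (\int |f|^q)^(2/q)].  Testing it on [|a|^(r/q)] cut off at
   [|a| <= N], with [r = 2q/(q-2)], gives [a] in [L^r] if [q > 2].  Testing it on
   indicators of [E] included in [{|a| > c}] gives [c^2 |E| <= C |E|^(2/q)]: if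
   [q = 2] this bounds [a], and if [q < 2] it excludes small [E] of positive
   measure, hence [a = 0] because Lebesgue measure has no atoms. *)
Require Import Defs.
From HB Require Import structures.
From mathcomp Require Import all_boot all_order all_algebra.
From mathcomp Require Import complex.
From mathcomp Require Import all_classical all_reals all_analysis.
From mathcomp Require Import measurable_realfun ess_sup_inf ring lra.
Set Implicit Arguments.
Unset Strict Implicit.
Unset Printing Implicit Defensive.
Import Order.TTheory GRing.Theory Num.Theory.
Import numFieldNormedType.Exports.
Local Open Scope classical_set_scope.
Local Open Scope ring_scope.

(** * Integrals of powers and inequalities of Hölder type *)

HB.lock Definition powint d (T : measurableType d) (R : realType)
    (mu : {measure set T -> \bar R}) (r : R) (f : T -> R) : \bar R :=
  (\int[mu]_x (`|f x| `^ r)%:E)%E.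

Section powint.
Context d (T : measurableType d) (R : realType).
Variable mu : {measure set T -> \bar R}.
Implicit Types (f g a : T -> R) (r q : R).

Local Notation powint := (powint mu).

Lemma powintE r f : powint r f = (\int[mu]_x (`|f x| `^ r)%:E)%E.
Proof. by rewrite powint.unlock. Qed.

Lemma measurable_normpow r f : measurable_fun setT f ->
  measurable_fun setT (fun x => `|f x| `^ r).
Proof.
move=> mf; apply: (@measurableT_comp _ _ _ _ _ _ (@powR R ^~ r)) => //.
exact: measurableT_comp.
Qed.

Lemma measurable_enormpow r f : measurable_fun setT f ->
  measurable_fun setT (fun x => (`|f x| `^ r)%:E).
Proof. by move=> mf; apply/measurable_EFinP/measurable_normpow. Qed.

Lemma powint_ge0 r f : (0 <= powint r f)%E.
Proof. by rewrite powintE; apply: integral_ge0 => x _; rewrite lee_fin powR_ge0. Qed.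

(** Taking the root of exponent [r^-1] preserves finiteness, so membership in L^r can be tested on
    the integral itself. *)
Lemma finite_norm_powint r f : 0 < r ->
  finite_norm mu r%:E f <-> (powint r f < +oo)%E.
Proof.
move=> r0; rewrite /finite_norm unlock powintE /=.
split; last exact: poweR_lty.
by apply: lty_poweRy; rewrite invr_eq0 gt_eqF.
Qed.

Lemma le_powint_ae r f g : 0 <= r -> measurable_fun setT f ->
  measurable_fun setT g -> {ae mu, forall x, `|f x| <= `|g x|} ->
  (powint r f <= powint r g)%E.
Proof.
move=> r0 mf mg fg; rewrite !powintE; apply: ae_ge0_le_integral => //.
- exact: measurable_enormpow.
- exact: measurable_enormpow.
- by apply: filterS fg => x fg _; rewrite lee_fin ge0_ler_powR ?nnegrE.
Qed.

Lemma powintZ r c f : measurable_fun setT f ->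
  powint r (fun x => c * f x) = ((`|c| `^ r)%:E * powint r f)%E.
Proof.
move=> mf; rewrite !powintE -ge0_integralZl_EFin ?powR_ge0//.
  by apply: eq_integral => x _; rewrite normrM powRM// EFinM.
exact: measurable_enormpow.
Qed.

(** A pointwise bound by a sum is enough for finiteness; it yields both the product rule for
    exponents and the inclusion of L^s in L^r. *)
Lemma powint_le_add (r s q : R) f g (h : T -> R) : measurable_fun setT f ->
  measurable_fun setT g -> measurable_fun setT h ->
  (forall x, `|h x| `^ r <= `|f x| `^ s + `|g x| `^ q) ->
  (powint s f < +oo)%E -> (powint q g < +oo)%E -> (powint r h < +oo)%E.
Proof.
move=> mf mg mh H fs gq; apply: (@le_lt_trans _ _ (powint s f + powint q g)%E).
  rewrite !powintE -ge0_integralD//; last 2 first.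
  - exact: measurable_enormpow.
  - exact: measurable_enormpow.
  apply: ge0_le_integral => //.
  - exact: measurable_enormpow.
  - by apply: emeasurable_funD; exact: measurable_enormpow.
  - by move=> x _; rewrite -EFinD lee_fin.
exact: lte_add_pinfty.
Qed.

(* Substitute for Young's inequality: the larger of [A^s] and [B^t] alone
   dominates the left-hand side. *)
Lemma powR_mul_le (A B r s t : R) : 0 <= A -> 0 <= B ->
  0 < r -> 0 < s -> 0 < t -> r * (s + t) = s * t ->
  (A * B) `^ r <= A `^ s + B `^ t.
Proof.
move=> A0 B0 r0 s0 t0 rst.
suff aux : forall (A B s t : R), 0 <= A -> 0 <= B -> 0 < s -> 0 < t ->
    r * (s + t) = s * t -> A `^ s <= B `^ t -> (A * B) `^ r <= B `^ t.
  case: (leP (A `^ s) (B `^ t)) => [AB|/ltW BA].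
    by apply: (le_trans (aux _ _ s t _ _ _ _ _ _)) => //; rewrite lerDr powR_ge0.
  rewrite mulrC; apply: (le_trans (aux _ _ t s _ _ _ _ _ _)) => //.
    by rewrite addrC rst mulrC.
  by rewrite lerDl powR_ge0.
move=> {}A {}B {}s {}t {}A0 {}B0 {}s0 {}t0 {}rst AB.
have sn0 := lt0r_neq0 s0.
have AB' : A <= B `^ (t / s).
  rewrite -(powRr1 A0) -(mulfV sn0) 2!powRrM.
  by rewrite ge0_ler_powR ?nnegrE ?powR_ge0// invr_ge0 ltW.
(* As A <= B^(t/s), the product is at most B^(t/s + 1), and r(s + t) = st gives (t/s + 1)r = t. *)
have -> : B `^ t = (B `^ (t / s) * B) `^ r.
  rewrite -{3}(powRr1 B0) -powRD; last by rewrite gt_eqF ?addr_gt0 ?divr_gt0.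
  rewrite -powRrM.
  congr (_ `^ _); have -> : (t / s + 1) * r = r * (s + t) / s by field.
  by rewrite rst mulrAC mulfV// mul1r.
by rewrite ge0_ler_powR ?nnegrE ?mulr_ge0 ?powR_ge0 ?(ltW r0)// ler_wpM2r.
Qed.

(** The condition on the exponents is Hölder's 1/r = 1/s + 1/t, cleared of denominators. *)
Lemma powint_mul (r s t : R) f g : 0 < r -> 0 < s -> 0 < t ->
  r * (s + t) = s * t -> measurable_fun setT f -> measurable_fun setT g ->
  (powint s f < +oo)%E -> (powint t g < +oo)%E ->
  (powint r (f \* g)%R < +oo)%E.
Proof.
move=> r0 s0 t0 rst mf mg.
apply: powint_le_add => //; first exact: measurable_funM.
by move=> x; rewrite normrM powR_mul_le.
Qed.

Lemma powint_cst r c : powint r (cst c) = ((`|c| `^ r)%:E * mu setT)%E.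
Proof. by rewrite powintE -(integral_cst mu measurableT). Qed.

(** Where |f| > 1, |f|^r is at most |f|^s; elsewhere it is at most 1, which is integrable for a
    finite measure. *)
Lemma powint_le_exp r s f : 0 < r <= s -> (mu setT < +oo)%E ->
  measurable_fun setT f -> (powint s f < +oo)%E -> (powint r f < +oo)%E.
Proof.
move=> /andP[r0 rs] muoo mf fs.
apply: (@powint_le_add r s 1 f (cst 1) f) => //; last first.
  by rewrite powint_cst normr1 powR1 mul1e.
move=> x; rewrite normr1 powR1.
have [f1|/ltW f1] := leP `|f x| 1; last by rewrite ler_wpDr// ler_powR.
rewrite ler_wpDl ?powR_ge0//.
have : `|f x| `^ r <= 1 `^ r by rewrite ge0_ler_powR ?nnegrE// ltW.
by rewrite powR1.
Qed.

Lemma powint_powR r s f : powint r (fun x => `|f x| `^ s) = powint (s * r) f.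
Proof.
by rewrite !powintE; apply: eq_integral => x _; rewrite ger0_norm ?powR_ge0// powRrM.
Qed.

End powint.

(** * Multipliers from L^q to L^2 *)

Section multiplier.
Context d (T : measurableType d) (R : realType).
Variable mu : {measure set T -> \bar R}.
Implicit Types (f g a : T -> R) (r q : R).
Local Notation powint := (powint mu).

Definition multiplier q a := forall f, measurable_fun setT f ->
  (powint q f < +oo)%E -> (powint 2 (f \* a)%R < +oo)%E.

(* Gliding hump: were the bounds [C] unattainable, [f_ j] in the unit ball of
   [L^q] witnessing the failure for [C j] would give a single function
   [(\sum_j 2^-(j+1) |f_ j|^q)^(1/q)] of [L^q] dominating a multiple of each
   [f_ j]. *)
Lemma multiplier_bound q a : 0 < q -> measurable_fun setT a ->
  multiplier q a -> exists C : R, forall f, measurable_fun setT f ->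
    (powint q f <= 1)%E -> (powint 2 (f \* a)%R <= C%:E)%E.
Proof.
move=> q0 ma qa; apply: contrapT => noC.
(* [C j] is the square of the factor c for which |f_j| <= c F below, so exceeding [C j * j] forces
   the integral of |F a|^2 above j. *)
pose C (j : nat) : R := ((2 ^+ j.+1) `^ q^-1) `^ 2.
have C0 j : 0 < C j by rewrite !powR_gt0// exprn_gt0.
have {noC} /choice[f Hf] : forall j : nat, exists f : T -> R,
    [/\ measurable_fun setT f, (powint q f <= 1)%E &
        ((C j * j%:R)%:E < powint 2 (f \* a)%R)%E].
  move=> j; apply: contrapT => nof; apply: noC; exists (C j * j%:R) => f mf f1.
  by rewrite leNgt; apply/negP => fC; apply: nof; exists f.
have mf j : measurable_fun setT (f j) by have [] := Hf j.
pose u j x := ((2 ^+ j.+1)^-1 * `|f j x| `^ q)%:E.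
have u0 j x : (0 <= u j x)%E.
  by rewrite lee_fin mulr_ge0 ?powR_ge0// invr_ge0 exprn_ge0.
have mu_ j : measurable_fun setT (u j).
  by apply/measurable_EFinP/measurable_funM => //; exact: measurable_normpow.
pose G x := (\sum_(j <oo) u j x)%E.
have mG : measurable_fun setT G by exact: ge0_emeasurable_sum.
have G0 x : (0 <= G x)%E by exact: nneseries_ge0.
have intG : (\int[mu]_x G x <= 1)%E.
  rewrite integral_nneseries//.
  have <- : (\sum_(j <oo) (1 / (2 ^ (j + 1))%:R)%:E = 1 :> \bar R)%E.
    have /cvg_lim := @cvg_geometric_eseries_half R 1 0.
    by rewrite expr0 divr1; exact.
  apply: lee_nneseries => // j _; first by rewrite integral_ge0.
  rewrite /u; under eq_integral do rewrite EFinM.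
  rewrite ge0_integralZl_EFin ?invr_ge0 ?exprn_ge0//; last first.
    exact: measurable_enormpow.
  rewrite addn1 div1r natrX -[leRHS]mule1.
  rewrite lee_wpmul2l ?lee_fin ?invr_ge0 ?exprn_ge0//.
  by have [_ + _] := Hf j; rewrite powintE.
have Gfin : {ae mu, forall x, G x \is a fin_num}.
  have /integrable_ae : mu.-integrable setT G.
    apply/integrableP; split => //.
    under eq_integral do rewrite gee0_abs//.
    by rewrite (le_lt_trans intG)// ltry.
  by move=> /(_ measurableT); apply: filterS => x; apply.
(* [fine] sends an infinite [G x] to 0, so the domination by [F] is claimed only where [G] is
   finite, that is almost everywhere. *)
pose F x := fine (G x) `^ q^-1.
have mF : measurable_fun setT F.
  apply: (@measurableT_comp _ _ _ _ _ _ (@powR R ^~ q^-1)) => //.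
  exact: measurableT_comp.
have Foo : (powint q F < +oo)%E.
  apply: (@le_lt_trans _ _ 1%E); last exact: ltry.
  apply: le_trans intG; rewrite powintE; apply: ge0_le_integral => //.
  - exact: measurable_enormpow.
  - move=> x _; rewrite ger0_norm ?powR_ge0// -powRrM mulVf ?gt_eqF//.
    by rewrite powRr1 ?fine_ge0//; case: (G x) (G0 x) => [r||]//=; rewrite leey.
have mFa : measurable_fun setT (F \* a)%R by exact: measurable_funM.
have key j : ((C j * j%:R)%:E < (C j)%:E * powint 2 (F \* a)%R)%E.
  have [_ _ /lt_le_trans] := Hf j; apply.
  set c := (2 ^+ j.+1) `^ q^-1.
  have c0 : 0 < c by rewrite powR_gt0// exprn_gt0.
  have -> : C j = `|c| `^ 2 by rewrite gtr0_norm.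
  rewrite -powintZ//.
  apply: le_powint_ae => //.
  - exact: measurable_funM.
  - exact: measurable_funM.
  apply: filterS Gfin => x Gx /=.
  rewrite mulrA !normrM ler_wpM2r// (gtr0_norm c0) (ger0_norm (powR_ge0 _ _)).
  rewrite /c -powRM ?fine_ge0 ?exprn_ge0//.
  have -> : `|f j x| = (`|f j x| `^ q) `^ q^-1.
    by rewrite -powRrM mulfV ?gt_eqF// powRr1.
  rewrite ge0_ler_powR ?nnegrE ?invr_ge0 ?powR_ge0 ?(ltW q0)//.
    by rewrite mulr_ge0 ?fine_ge0// exprn_ge0.
  rewrite -ler_pdivrMl ?exprn_gt0// -lee_fin fineK//.
  (* The partial sum over indices below [j.+1] already contains the term [u j x]. *)
  apply: le_trans (nneseries_lim_ge j.+1 _) => //.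
  by rewrite big_nat_recr//= leeDr// sume_ge0.
have Fa : powint 2 (F \* a)%R \is a fin_num.
  by rewrite ge0_fin_numE ?powint_ge0// qa.
have [n Hn] : exists n : nat, fine (powint 2 (F \* a)%R) < n%:R.
  by exists (Num.truncn (fine (powint 2 (F \* a)%R))).+1; exact: truncnS_gt.
have := key n; rewrite -(fineK Fa) -EFinM lte_fin ltr_pM2l//.
by move=> /(lt_trans Hn); rewrite ltxx.
Qed.

Lemma powint_eq0 r f : measurable_fun setT f -> powint r f = 0%E ->
  {ae mu, forall x, f x = 0}.
Proof.
move=> mf f0; have /ae_eq_integral_abs : (\int[mu]_x `|(`|f x| `^ r)%:E| = 0)%E.
  rewrite -f0 powintE; apply: eq_integral => x _.
  by rewrite gee0_abs ?lee_fin ?powR_ge0//.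
move=> /(_ measurableT (measurable_enormpow _ mf)).
by apply: filterS => x /(_ I) [] /powR_eq0_eq0 /normr0_eq0.
Qed.

(** Homogeneity: dividing f by c, the root of exponent 1/q of its integral I, puts it in the unit
    ball and divides the left-hand side by c^2 = I^(2/q). If I = 0, then f a vanishes almost
    everywhere. *)
Lemma multiplier_bound_powint q a : 0 < q -> measurable_fun setT a ->
  multiplier q a -> exists2 C : R, 0 <= C & forall f, measurable_fun setT f ->
    (powint q f < +oo)%E ->
    (powint 2 (f \* a)%R <= (C * fine (powint q f) `^ (2 / q))%:E)%E.
Proof.
move=> q0 ma qa; have [C HC] := multiplier_bound q0 ma qa.
exists `|C| => // f mf foo.
have mfa : measurable_fun setT (f \* a)%R by exact: measurable_funM.
have Ifin : powint q f \is a fin_num by rewrite ge0_fin_numE ?powint_ge0.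
have [I0|I0] := eqVneq (powint q f) 0%E.
  have fa0 : {ae mu, forall x, `|(f \* a) x| <= `|(cst 0 : T -> R) x|}.
    by apply: filterS (powint_eq0 mf I0) => x /= ->; rewrite mul0r.
  apply: le_trans (le_powint_ae (r := 2) _ mfa _ fa0) _ => //.
  rewrite powint_cst normr0 powR0 ?pnatr_eq0// mul0e lee_fin.
  by rewrite mulr_ge0// powR_ge0.
set I := fine _.
have Igt0 : 0 < I by rewrite fine_gt0// lt0e I0 powint_ge0 -ge0_fin_numE ?powint_ge0.
pose c := I `^ q^-1.
have c0 : 0 < c by rewrite powR_gt0.
have := HC (fun x => c^-1 * f x) (measurable_funM (measurable_cst _) mf).
rewrite powintZ// -(fineK Ifin) -/I -EFinM ger0_norm ?invr_ge0 ?(ltW c0)//.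
rewrite -{1}powR_inv1 ?(ltW c0)// -!powRrM mulrA mulrN mulr1 mulNr mulVf ?gt_eqF//.
rewrite powR_inv1 ?(ltW Igt0)// mulVf ?gt_eqF// => /(_ (lexx _)).
have -> : ((fun x => c^-1 * f x) \* a)%R = (fun x => c^-1 * (f \* a) x).
  by apply/funext => x /=; rewrite mulrA.
rewrite powintZ// => H.
have -> : I `^ (2 / q) = c `^ 2 by rewrite -powRrM mulrC.
rewrite EFinM -lee_pdivrMr ?powR_gt0//.
apply: le_trans (_ : C%:E <= _)%E; last by rewrite lee_fin ler_norm.
apply: le_trans H; rewrite muleC normfV (gtr0_norm c0).
by rewrite -(powR_inv1 (ltW c0)) -powRrM mulrC powRrM powR_inv1 ?powR_ge0.
Qed.

(** The test function is the indicator of E: its power integrals all equal the measure of E, and its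
    product with a has modulus at least c on E. *)
Lemma multiplier_level q a : 0 < q -> measurable_fun setT a ->
  (mu setT < +oo)%E -> multiplier q a ->
  exists2 C : R, 0 <= C & forall (E : set T) c, measurable E -> 0 <= c ->
    (forall x, E x -> c <= `|a x|) ->
    c ^+ 2 * fine (mu E) <= C * fine (mu E) `^ (2 / q).
Proof.
move=> q0 ma muoo qa; have [C C0 HC] := multiplier_bound_powint q0 ma qa.
exists C => // E c mE c0 cE.
have mI : measurable_fun setT (\1_E : T -> R) by exact: measurable_indic.
have pI r : 0 < r -> powint r (\1_E : T -> R) = mu E.
  move=> r0; rewrite -(setIT E) -integral_indic ?setIT//.
  rewrite powintE; apply: eq_integral => x _; rewrite indicE.
  by case: (x \in E); rewrite ?normr1 ?powR1// normr0 powR0// gt_eqF.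
have muE : mu E \is a fin_num.
  by rewrite ge0_fin_numE// (le_lt_trans _ muoo)// le_measure ?inE.
have := HC _ mI; rewrite pI// -ge0_fin_numE// => /(_ muE).
move=> H; rewrite -lee_fin; apply: le_trans H; rewrite EFinM fineK//.
rewrite -(pI 2%R)// -powR_mulrn// -{1}(ger0_norm c0) -powintZ//.
apply: le_powint_ae => //.
- exact: measurable_funM.
- exact: measurable_funM.
apply: aeW => x /=; rewrite indicE; case: (boolP (x \in E)) => xE.
  by rewrite mulr1 mul1r (ger0_norm c0) cE//; rewrite inE in xE.
by rewrite mulr0 mul0r.
Qed.

Lemma measurable_gt_norm c a : measurable_fun setT a ->
  measurable [set x | c < `|a x|].
Proof.
move=> ma; rewrite -[X in measurable X]setTI.
have ma' : measurable_fun setT (fun x => `|a x|) by exact: measurableT_comp.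
have := ma' measurableT _ (measurable_itv `]c, +oo[).
by congr measurable; apply/seteqP; split => x /=; rewrite in_itv/= andbT.
Qed.

Lemma multiplier2P a : measurable_fun setT a -> (mu setT < +oo)%E ->
  multiplier 2 a <-> exists M : R, {ae mu, forall x, `|a x| <= M}.
Proof.
move=> ma muoo; split=> [m2a|[M aM] f mf foo].
  have [C C0 HC] := multiplier_level (ltr0n _ 2) ma muoo m2a.
  (* For q = 2 the exponent 2/q is 1, and (C + 1)^2 > C, so the set where |a| > C + 1 must be
     null. *)
  exists (C + 1); exists [set x | C + 1 < `|a x|]; split.
  - exact: measurable_gt_norm.
  - have mE := measurable_gt_norm (C + 1) ma.
    have muE : mu [set x | C + 1 < `|a x|] \is a fin_num.
      by rewrite ge0_fin_numE// (le_lt_trans _ muoo)// le_measure ?inE.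
    have := HC _ (C + 1) mE (addr_ge0 C0 ler01) (fun x => @ltW _ _ _ _).
    rewrite divff ?pnatr_eq0// powRr1 ?fine_ge0// => H.
    rewrite -(fineK muE); congr EFin; apply/eqP; rewrite eq_le fine_ge0// andbT.
    have : ((C + 1) ^+ 2 - C) * fine (mu [set x | C + 1 < `|a x|]) <= 0.
      by rewrite mulrBl subr_le0.
    rewrite pmulr_rle0//; nra.
  - by move=> x /= /negP; rewrite -ltNge.
apply: (@le_lt_trans _ _ (powint 2 (fun x => M * f x))).
  apply: le_powint_ae => //.
  - exact: measurable_funM.
  - exact: measurable_funM.
  apply: filterS aM => x aM /=; rewrite mulrC !normrM ler_wpM2r//.
  by rewrite (le_trans aM)// ler_norm.
by rewrite powintZ// lte_mul_pinfty// ?lee_fin ?powR_ge0.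
Qed.

(** Absence of atoms enters as countable covers by sets of measure at most e. Since 2/q > 1, a set
    of measure m > 0 on which |a| > c satisfies c^2 <= C m^(2/q - 1), so m cannot be small: each
    piece of a fine cover meets the set where |a| > c in a null set. *)
Lemma multiplier_lt2P q a : 0 < q < 2 -> measurable_fun setT a ->
  (mu setT < +oo)%E ->
  (forall e : R, 0 < e -> exists F : (set T)^nat,
    [/\ forall n, measurable (F n), \bigcup_n F n = setT &
        forall n, (mu (F n) <= e%:E)%E]) ->
  multiplier q a <-> {ae mu, forall x, a x = 0}.
Proof.
move=> /andP[q0 q2] ma muoo diffuse; split=> [qa|a0 f mf _]; last first.
  apply: (@le_lt_trans _ _ (powint 2 (cst 0 : T -> R))).
    apply: le_powint_ae => //; first exact: measurable_funM.
    by apply: filterS a0 => x /= ->; rewrite mulr0.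
  by rewrite powint_cst normr0 powR0 ?pnatr_eq0// mul0e.
have [C C0 HC] := multiplier_level q0 ma muoo qa.
have e0 : 0 < 2 / q - 1 by rewrite subr_gt0 ltr_pdivlMr// mul1r.
have null (c : R) : 0 < c -> mu [set x | c < `|a x|] = 0%E.
  move=> c0; have C1 : 0 < C + 1 by lra.
  (* This solves (C + 1) eps^(2/q - 1) = c^2; adding 1 to C makes the contradiction strict and the
     division legitimate. *)
  pose eps := (c ^+ 2 / (C + 1)) `^ (2 / q - 1)^-1.
  have eps0 : 0 < eps by rewrite powR_gt0// divr_gt0// exprn_gt0.
  have [F [mF FT Feps]] := diffuse _ eps0.
  have mE := measurable_gt_norm c ma.
  apply/negligibleP => //; set E := [set x | _] in mE *.
  rewrite -[E]setIT -FT setI_bigcupr; apply: negligible_bigcup => n.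
  have mEF : measurable (E `&` F n) by exact: measurableI.
  have le_eps : (mu (E `&` F n) <= eps%:E)%E.
    by apply: le_trans (Feps n); rewrite le_measure ?inE//; exact: subIsetr.
  have EFfin : mu (E `&` F n) \is a fin_num.
    by rewrite ge0_fin_numE// (le_lt_trans le_eps)// ltry.
  have Hm := HC _ _ mEF (ltW c0) (fun x Hx => ltW (proj1 Hx)).
  suff : mu (E `&` F n) = 0%E by move=> ?; exact/negligibleP.
  rewrite -(fineK EFfin); congr EFin.
  rewrite -(fineK EFfin) lee_fin in le_eps.
  set m := fine _ in Hm le_eps *.
  have [//|m0] := eqVneq m 0.
  have {m0} mgt0 : 0 < m by rewrite lt0r m0 fine_ge0.
  have : m `^ (2 / q - 1) <= c ^+ 2 / (C + 1).
    rewrite [leRHS](_ : _ = eps `^ (2 / q - 1)); last first.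
      by rewrite -powRrM mulVf ?gt_eqF// powRr1// divr_ge0 ?exprn_ge0 ?ltW.
    by rewrite ge0_ler_powR ?nnegrE ?(ltW e0) ?(ltW eps0) ?(ltW mgt0).
  rewrite ler_pdivlMr// => Hm'.
  have := Hm; rewrite -[X in _ <= _ * (_ `^ X)](subrK 1) powRD; last first.
    by rewrite (gt_eqF mgt0) implybT.
  rewrite powRr1 ?(ltW mgt0)// mulrA ler_pM2r// => Hm2.
  have : 0 < m `^ (2 / q - 1) by rewrite powR_gt0.
  nra.
have : {ae mu, forall x, forall n : nat, `|a x| <= n.+1%:R^-1}.
  apply/ae_foralln => n.
  exists [set x | n.+1%:R^-1 < `|a x|]; split.
  - exact: measurable_gt_norm.
  - by rewrite null.
  - by move=> x /= /negP; rewrite -ltNge.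
apply: filterS => x ax; apply/normr0_eq0/eqP; rewrite eq_le normr_ge0 andbT.
rewrite leNgt; apply/negP => ax0.
have := ax (Num.truncn `|a x|^-1); apply/negP; rewrite -ltNge.
by rewrite invf_plt ?posrE ?ltr0n// truncnS_gt.
Qed.

(** The exponent r satisfies 1/2 = 1/q + 1/r, so one direction is Hölder. For the other, truncating
    a at height n makes the integral I of its r-th power finite; the test function gives I <= C
    I^(2/q), hence a bound on I independent of n. *)
Lemma multiplier_gt2P q a : 2 < q -> measurable_fun setT a ->
  (mu setT < +oo)%E ->
  multiplier q a <-> (powint (2 * q / (q - 2)) a < +oo)%E.
Proof.
move=> q2 ma muoo; set r := 2 * q / (q - 2).
have q0 : 0 < q by lra.
have q20 : 0 < q - 2 by lra.
have r0 : 0 < r by rewrite divr_gt0// mulr_gt0.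
have rq : 2 * (q + r) = q * r by rewrite /r; field; rewrite gt_eqF.
split=> [qa|ra f mf fq]; last exact: (@powint_mul _ _ _ _ 2 q r).
have [C C0 HC] := multiplier_bound_powint q0 ma qa.
pose E (n : nat) := [set x | `|a x| <= n%:R].
have mE n : measurable (E n).
  rewrite (_ : E n = ~` [set x | n%:R < `|a x|]).
    by apply: measurableC; exact: measurable_gt_norm.
  by apply/seteqP; split => x; rewrite /E /= leNgt => /negP.
pose b n x := \1_(E n) x * a x.
have mb n : measurable_fun setT (b n).
  by apply: measurable_funM => //; exact: measurable_indic.
have bE n : powint r (b n) = (\int[mu]_(x in E n) (`|a x| `^ r)%:E)%E.
  rewrite powintE [RHS]integral_mkcond; apply: eq_integral => x _.
  rewrite patchE /b indicE; case: (x \in E n); first by rewrite mul1r.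
  by rewrite mul0r normr0 powR0// gt_eqF.
have boo n : (powint r (b n) < +oo)%E.
  apply: (@le_lt_trans _ _ (powint r (cst n%:R))); last first.
    by rewrite powint_cst lte_mul_pinfty// lee_fin powR_ge0.
  apply: le_powint_ae => //; first exact: ltW.
  apply: aeW => x /=; rewrite /b indicE [leRHS]ger0_norm//.
  case: (boolP (x \in E n)) => [|_]; last by rewrite mul0r normr0.
  by rewrite inE /E /= mul1r.
have e0 : 0 < 1 - 2 / q by rewrite subr_gt0 ltr_pdivrMr// mul1r.
have bC n : (powint r (b n) <= (C `^ (1 - 2 / q)^-1)%:E)%E.
  have bfin : powint r (b n) \is a fin_num by rewrite ge0_fin_numE ?powint_ge0.
  have := HC (fun x => `|b n x| `^ (r / q)) (measurable_normpow _ (mb n)).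
  rewrite powint_powR divfK ?gt_eqF// => /(_ (boo n)).
  (* Both sides of the estimate involve the same integral, since (r/q + 1) 2 = r. *)
  have -> : powint 2 ((fun x => `|b n x| `^ (r / q)) \* a)%R = powint r (b n).
    rewrite !powintE; apply: eq_integral => x _ /=; congr EFin.
    rewrite /b indicE; case: (x \in E n); last first.
      rewrite mul0r normr0 powR0 ?mulf_neq0 ?invr_eq0 ?gt_eqF// mul0r.
      by rewrite normr0 !powR0// gt_eqF.
    rewrite mul1r normrM ger0_norm ?powR_ge0// -{2}(powRr1 (normr_ge0 (a x))).
    have rq0 : 0 < r / q by rewrite divr_gt0.
    rewrite -powRD; last by rewrite (gt_eqF (addr_gt0 rq0 ltr01)).
    rewrite -powRrM; congr (_ `^ _).
    by rewrite /r; field; rewrite !gt_eqF.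
  rewrite -{1 3}(fineK bfin) !lee_fin; set I := fine _.
  have [->|I0] := eqVneq I 0; first by rewrite powR_ge0.
  have {I0} Igt0 : 0 < I by rewrite lt0r I0 fine_ge0// powint_ge0.
  rewrite -ler_pdivrMr ?powR_gt0// -{1}(powRr1 (ltW Igt0)).
  rewrite -powRB ?(gt_eqF Igt0) ?implybT//.
  move=> IC; have -> : I = (I `^ (1 - 2 / q)) `^ (1 - 2 / q)^-1.
    by rewrite -powRrM mulfV ?gt_eqF// powRr1// ltW.
  by rewrite ge0_ler_powR ?nnegrE ?powR_ge0// invr_ge0 ltW.
have EU : \bigcup_n E n = setT.
  apply/seteqP; split => // x _; exists (Num.truncn `|a x|).+1 => //=.
  by rewrite /E /= ltW// truncnS_gt.
apply: (@le_lt_trans _ _ (C `^ (1 - 2 / q)^-1)%:E); last exact: ltry.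
have mf n : measurable_fun (E n) (fun x => (`|a x| `^ r)%:E).
  by apply: measurable_funS (measurable_enormpow _ ma).
have ndE : nondecreasing_seq E.
  move=> m n mn; rewrite subsetEset => x /le_trans; apply.
  by rewrite ler_nat.
(* Monotone convergence along the increasing sets [E n] removes the truncation. *)
have cv := @ge0_nondecreasing_set_cvg_integral _ T R E _ mu ndE mE mf
  (fun _ _ _ => powR_ge0 _ _).
rewrite powintE -EU -(cvg_lim _ cv)//.
apply: lime_le; first exact: cvgP cv.
by apply: nearW => n; rewrite -bE.
Qed.

End multiplier.

(** * Factorisation of L^r as the product of L^s and L^t *)

Section multiplier_factor.
Context d (T : measurableType d) (R : realType).
Variable mu : {measure set T -> \bar R}.

(** Hölder puts products of L^s and L^t in L^r; conversely |f| = |f|^(r/s) |f|^(r/t), with factors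
    in L^s and L^t. *)
Lemma multiplier_factor (r s t : R) (a : T -> R) : 0 < r -> 0 < s -> 0 < t ->
  r * (s + t) = s * t -> measurable_fun setT a ->
  multiplier mu r a <-> (forall x, measurable_fun setT x ->
    (powint mu s x < +oo)%E -> multiplier mu t (x \* a)).
Proof.
move=> r0 s0 t0 rst ma; split=> [ra x mx xs f mf ft|H f mf fr].
  rewrite (_ : f \* (x \* a) = (x \* f) \* a); last first.
    by apply/funext => y /=; rewrite mulrCA mulrA.
  apply: ra; first exact: measurable_funM.
  exact: (powint_mul r0 s0 t0).
have := H (fun y => `|f y| `^ (r / s)) (measurable_normpow _ mf).
rewrite powint_powR divfK ?gt_eqF// => /(_ fr).
move=> /(_ (fun y => `|f y| `^ (r / t)) (measurable_normpow _ mf)).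
rewrite powint_powR divfK ?gt_eqF// => /(_ fr); apply: le_lt_trans.
apply: le_powint_ae => //; [exact: measurable_funM| |apply: aeW => y /=].
  by do 2 (apply: measurable_funM => //; first exact: measurable_normpow).
rewrite mulrA !normrM ler_wpM2r// !(ger0_norm (powR_ge0 _ _)) -powRD.
  have -> : r / t + r / s = r * (s + t) / (s * t) by field; rewrite !gt_eqF.
  by rewrite rst divff ?mulf_neq0 ?gt_eqF// powRr1.
by rewrite gt_eqF// addr_gt0 ?divr_gt0.
Qed.

End multiplier_factor.

(** * Difference quotients of sine and cosine *)

Section trigonometric_quotients.
Variable R : realType.
Implicit Types (t y : R) (u : R^nat).

(** Mean value theorem; for sine and cosine it gives bounds on the difference quotients that do not
    depend on t. *)
Lemma lipschitz_derive (f df : R -> R) :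
  (forall x : R, is_derive x 1 f (df x)) -> (forall x, `|df x| <= 1) ->
  forall y, `|f y - f 0| <= `|y|.
Proof.
move=> Df df1 y.
have cf : continuous f.
  by move=> x; apply/differentiable_continuous/derivable1_diffP; have [] := Df x.
have le_df (a b : R) : a <= b -> `|f b - f a| <= `|b - a|.
  move=> ab; have [c _ ->] := MVT_segment ab (fun x _ => Df x)
    (continuous_subspaceT cf).
  by rewrite normrM ler_piMl.
have [y0|/ltW y0] := leP 0 y; first by have := le_df _ _ y0; rewrite subr0.
by have := le_df _ _ y0; rewrite sub0r normrN distrC.
Qed.

Lemma sin_le_norm y : `|sin y| <= `|y|.
Proof.
by have := lipschitz_derive (@is_derive_sin R) (@cos_max R) y; rewrite sin0 subr0.
Qed.

Lemma cos_le_norm y : `|cos y - 1| <= `|y|.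
Proof.
have sin_max' x : `|- sin x| <= 1 :> R by rewrite normrN sin_max.
by have := lipschitz_derive (@is_derive_cos R) sin_max' y; rewrite cos0.
Qed.

(** The increment is rescaled to [u n * y], which must be nonzero; hence y = 0 is treated apart. *)
Lemma cvg_derive_quot (f : R -> R) (df y : R) u : is_derive (0 : R) 1 f df ->
  (forall n, u n != 0) -> u n @[n --> \oo] --> 0 ->
  (u n)^-1 * (f (u n * y) - f 0) @[n --> \oo] --> df * y.
Proof.
move=> Df u0 cu.
have [->|y0] := eqVneq y 0.
  under eq_fun do rewrite mulr0 subrr mulr0.
  by rewrite mulr0; exact: cvg_cst.
have : h^-1 *: (f (h *: 1 + 0) - f 0) @[h --> 0^'] --> df.
  by have [+ <-] := Df.
move=> /cvgr_dnbhsP /(_ (fun n => u n * y)) H.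
have {}H : (u n * y)^-1 * (f (u n * y) - f 0) @[n --> \oo] --> df.
  under eq_fun do rewrite -[u _ * y]mulr1 -[u _ * y * 1]addr0.
  under eq_fun do rewrite {1}addr0 {1}mulr1.
  apply: H; split=> [n|]; first by rewrite mulf_neq0.
  by rewrite -(mul0r y); apply: cvgM cu (cvg_cst _).
under eq_fun => n.
  rewrite (_ : _ * _ = (u n * y)^-1 * (f (u n * y) - f 0) * y); last first.
    by field; rewrite u0 y0.
  over.
exact: cvgM H (cvg_cst _).
Qed.

End trigonometric_quotients.

(** * Almost everywhere classes on the unit interval *)

Section classes.
Variable R : realType.
Local Notation TR := (measurableTypeR R).
Local Notation TC := (measurableTypeC R).
Local Notation mu := (@leb01 R).
Local Notation L0R := {mfun_ mu, TR >-> TR}.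
Local Notation L0C := {mfun_ mu, TR >-> TC}.
Local Notation normc := (@Normc.normc R).

(** The canonical representative agrees with the given function only almost everywhere, so formulas
    for operations on classes hold in that sense. *)
Lemma repr_pi_ae d (V : measurableType d) (u : {mfun TR >-> V}) :
  {ae mu, forall s, (\pi_({mfun_ mu, TR >-> V})%qT u : {mfun_ mu, TR >-> V}) s = u s}.
Proof.
have /eqmodP /asboolP : repr (\pi_({mfun_ mu, TR >-> V})%qT u) = u
    %[mod {mfun_ mu, TR >-> V}]%qT.
  by rewrite reprK.
by apply: filterS => s; apply.
Qed.

Lemma class_eqP d (V : measurableType d) (u v : {mfun_ mu, TR >-> V}) :
  u = v <-> {ae mu, forall s, u s = v s}.
Proof.
split=> [->|uv]; first exact: aeW.
rewrite -(reprK u) -(reprK v); apply/eqmodP/asboolP.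
by apply: filterS uv => s uv _.
Qed.

Definition modulus (xi : L0C) (s : TR) : R := normc (xi s : R[i]).

Lemma normc_sqrE (z : R[i]) : normc z ^+ 2 = complex.Re z ^+ 2 + complex.Im z ^+ 2.
Proof. by case: z => a b; rewrite /= sqr_sqrtr// addr_ge0 ?sqr_ge0. Qed.

Lemma normc_ge0 (z : R[i]) : 0 <= normc z.
Proof. by case: z => a b; rewrite /= sqrtr_ge0. Qed.

Lemma measurable_normc (u v : TR -> R) :
  measurable_fun setT u -> measurable_fun setT v ->
  measurable_fun setT (fun s => normc (u s +i* v s)%C).
Proof.
move=> mmu mv; apply: (@measurableT_comp _ _ _ _ _ _ (@Num.sqrt R)).
  by apply: continuous_measurable_fun; exact: sqrt_continuous.
by apply: measurable_funD; apply: measurable_funX.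
Qed.

Lemma measurable_Re (xi : L0C) :
  measurable_fun setT (fun s => complex.Re (xi s : R[i])).
Proof. by have /measurable_funCP[] := @measurable_funPT _ _ _ _ (repr xi). Qed.

Lemma measurable_Im (xi : L0C) :
  measurable_fun setT (fun s => complex.Im (xi s : R[i])).
Proof. by have /measurable_funCP[] := @measurable_funPT _ _ _ _ (repr xi). Qed.

Lemma measurable_modulus (xi : L0C) : measurable_fun setT (modulus xi).
Proof.
have := measurable_normc (measurable_Re xi) (measurable_Im xi).
by congr measurable_fun; apply/funext => s; rewrite /modulus; case: (xi s : R[i]).
Qed.

Lemma measurable_class (x : L0R) : measurable_fun setT (x : TR -> R).
Proof. exact: (@measurable_funPT _ _ _ _ (repr x)). Qed.

Lemma LR_powint q (x : L0R) : 0 < q ->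
  LR q%:E x <-> (powint mu q x < +oo)%E.
Proof. exact: finite_norm_powint. Qed.

Lemma LC_powint q (xi : L0C) : 0 < q ->
  LC q%:E xi <-> (powint mu q (modulus xi) < +oo)%E.
Proof. exact: finite_norm_powint. Qed.

Lemma leb01E (A : set TR) : mu A = lebesgue_measure (A `&` `[0, 1]%classic).
Proof. by []. Qed.

Lemma leb01_setT : mu setT = 1%E.
Proof.
by rewrite leb01E setTI lebesgue_measure_itv/= lte_fin ltr01 -EFinB subr0.
Qed.

Lemma leb01_fin : (mu setT < +oo)%E.
Proof. by rewrite leb01_setT ltry. Qed.

(** The half-line from 0 is cut into intervals of length e; index 0 is the negative half-line, null
    because the measure lives on [0,1]. *)
Lemma leb01_diffuse (e : R) : 0 < e -> exists F : (set TR)^nat,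
  [/\ forall n, measurable (F n), \bigcup_n F n = setT &
      forall n, (mu (F n) <= e%:E)%E].
Proof.
move=> e0; pose F n : set TR :=
  if n is m.+1 then `[(m%:R * e), (m.+1%:R * e)[%classic else `]-oo, 0[%classic.
exists F; split.
- by case=> [|n]; exact: measurable_itv.
- apply/seteqP; split => // x _.
  have [x0|x0] := ltP x 0; first by exists 0%N => //=; rewrite in_itv.
  exists (Num.truncn (x / e)).+1 => //=; rewrite in_itv/=.
  by rewrite -ler_pdivlMr// -ltr_pdivrMr// truncn_itv// divr_ge0// ltW.
- case=> [|n]; rewrite leb01E.
    rewrite (_ : _ `&` _ = set0) ?measure0 ?lee_fin ?ltW//.
    apply/seteqP; split => // x [] /=; rewrite !in_itv/= => x0 /andP[].
    by rewrite leNgt x0.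
  apply: (@le_trans _ _ (lebesgue_measure `[(n%:R * e), (n.+1%:R * e)[%classic)).
    apply: le_measure; rewrite ?inE; last exact: subIsetl.
      by apply: measurableI; exact: measurable_itv.
    exact: measurable_itv.
  rewrite lebesgue_measure_itv/= lte_fin ltr_pM2r// ltr_nat ltnSn.
  by rewrite -EFinB -mulrBl -natr1 addrAC subrr add0r mul1r.
Qed.

Lemma mulL0_ae (f : L0R) (xi : L0C) :
  {ae mu, forall s, mulL0 f xi s = (f s)%:C%C * (xi s : R[i])}.
Proof. exact: repr_pi_ae. Qed.

Lemma modulus_mulL0_ae (f : L0R) (xi : L0C) :
  {ae mu, forall s, `|modulus (mulL0 f xi) s| = `|f s * modulus xi s|}.
Proof.
apply: filterS (mulL0_ae f xi) => s; rewrite /modulus => ->.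
rewrite Normc.normcM normrM [in RHS]normrM; congr (_ * _).
by rewrite /= expr0n /= addr0 sqrtr_sqr normr_id.
Qed.

Lemma eq_powint_ae (r : R) (f g : TR -> R) : 0 <= r -> measurable_fun setT f ->
  measurable_fun setT g -> {ae mu, forall s, `|f s| = `|g s|} ->
  powint mu r f = powint mu r g.
Proof.
move=> r0 mf mg fg; apply/eqP; rewrite eq_le !le_powint_ae//;
by apply: filterS fg => s ->.
Qed.

Lemma L2C_mulL0 (f : L0R) (xi : L0C) :
  L2C (mulL0 f xi) <-> (powint mu 2 (f \* modulus xi)%R < +oo)%E.
Proof.
have mfxi : measurable_fun setT (f \* modulus xi)%R.
  by apply: measurable_funM; [exact: measurable_class|exact: measurable_modulus].
rewrite /L2C LC_powint// (eq_powint_ae (g := (f \* modulus xi)%R))//.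
  exact: measurable_modulus.
exact: modulus_mulL0_ae.
Qed.

Lemma multiplier_ae (q : R) (a b : TR -> R) : measurable_fun setT a ->
  measurable_fun setT b -> {ae mu, forall s, `|a s| = `|b s|} ->
  multiplier mu q a -> multiplier mu q b.
Proof.
move=> ma mb ab qa f mf fq; apply: le_lt_trans (qa f mf fq).
apply: le_powint_ae => //; [exact: measurable_funM|exact: measurable_funM|].
by apply: filterS ab => s /= abs; rewrite !normrM abs.
Qed.

Lemma exists_class (f : TR -> R) : measurable_fun setT f ->
  exists F : L0R, {ae mu, forall s, F s = f s}.
Proof.
move=> mf; pose F : {mfun TR >-> TR} :=
  HB.pack (f : TR -> TR) (isMeasurableFun.Build _ _ TR TR f mf).
by exists (\pi_(L0R)%qT F); exact: repr_pi_ae.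
Qed.

Lemma LR_ae (q : R) (F : L0R) (f : TR -> R) : 0 < q -> measurable_fun setT f ->
  {ae mu, forall s, F s = f s} -> LR q%:E F <-> (powint mu q f < +oo)%E.
Proof.
move=> q0 mf Ff; rewrite LR_powint// (eq_powint_ae (g := f))//; first exact: ltW.
  exact: measurable_class.
by apply: filterS Ff => s ->.
Qed.

Lemma D_LP (q : R) (xi : L0C) : 0 < q ->
  D_L q xi <-> multiplier mu q (modulus xi).
Proof.
move=> q0; split=> [[_ H] f mf fq|H].
  have [F Ff] := exists_class mf.
  have /H/L2C_mulL0 : LR q%:E F by apply/(LR_ae q0 mf Ff).
  rewrite (eq_powint_ae (g := (f \* modulus xi)%R))//.
  - by apply: measurable_funM; [exact: measurable_class|exact: measurable_modulus].
  - by apply: measurable_funM => //; exact: measurable_modulus.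
  - by apply: filterS Ff => s /= ->.
split.
  (* Square integrability of xi is the multiplier condition at f = 1, which is in L^q since the
     measure is finite. *)
  rewrite /L2C LC_powint// -(mul1r (modulus xi)).
  have := H (cst 1) (measurable_cst _).
  rewrite powint_cst normr1 powR1 mul1e => /(_ leb01_fin).
  by congr (_ < _)%E.
move=> f /(LR_powint _ q0) fq; apply/L2C_mulL0/H => //.
exact: measurable_class.
Qed.

End classes.

(** * The derivative of the representation along a line *)

Section derivative.
Variable R : realType.
Local Notation TR := (measurableTypeR R).
Local Notation TC := (measurableTypeC R).
Local Notation mu := (@leb01 R).
Local Notation L0R := {mfun_ mu, TR >-> TR}.
Local Notation L0C := {mfun_ mu, TR >-> TC}.
Local Notation normc := (@Normc.normc R).
Implicit Types (x : L0R) (xi eta : L0C).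

Definition iM (y : R) (z : R[i]) : R[i] := (0 +i* y)%C * z.

(** Squaring removes the root, leaving a polynomial in the real quotients of cos - 1 and sin. *)
Lemma sqr_normc_diff_quot (t y : R) (z e : R[i]) :
  normc (t^-1%:C%C * (expi (t * y) * z - z) - e) ^+ 2 =
  (t^-1 * (cos (t * y) - 1) * complex.Re z - t^-1 * sin (t * y) * complex.Im z
    - complex.Re e) ^+ 2 +
  (t^-1 * (cos (t * y) - 1) * complex.Im z + t^-1 * sin (t * y) * complex.Re z
    - complex.Im e) ^+ 2.
Proof.
by case: z e => [a b] [c d]; rewrite normc_sqrE /expi /=; congr (_ + _); ring.
Qed.

Lemma cvg_sqr (v : R^nat) (l : R) :
  v n @[n --> \oo] --> l -> v n ^+ 2 @[n --> \oo] --> l ^+ 2.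
Proof.
by move=> cv; rewrite expr2; under eq_fun do rewrite expr2; exact: cvgM.
Qed.

Lemma cvg_sqr_normc_diff_quot (u : R^nat) (y : R) (z e : R[i]) :
  (forall n, u n != 0) -> u n @[n --> \oo] --> 0 ->
  normc ((u n)^-1%:C%C * (expi (u n * y) * z - z) - e) ^+ 2 @[n --> \oo] -->
  normc (iM y z - e) ^+ 2.
Proof.
move=> u0 cu; under eq_fun do rewrite sqr_normc_diff_quot.
have cA : (u n)^-1 * (cos (u n * y) - 1) @[n --> \oo] --> (0 : R).
  have := cvg_derive_quot (y := y) (@is_derive_cos R 0) u0 cu.
  by rewrite sin0 oppr0 mul0r cos0.
have cB : (u n)^-1 * sin (u n * y) @[n --> \oo] --> (y : R).
  have := cvg_derive_quot (y := y) (@is_derive_sin R 0) u0 cu.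
  by rewrite cos0 mul1r sin0; under eq_fun do rewrite subr0.
have -> : normc (iM y z - e) ^+ 2 =
    (0 * complex.Re z - y * complex.Im z - complex.Re e) ^+ 2 +
    (0 * complex.Im z + y * complex.Re z - complex.Im e) ^+ 2.
  by case: z e => [a b] [c d]; rewrite normc_sqrE /iM /=; congr (_ + _); ring.
by apply: cvgD; apply: cvg_sqr; apply: cvgB (cvg_cst _);
  [apply: cvgB|apply: cvgD]; apply: cvgM => //; exact: cvg_cst.
Qed.

Lemma le_sqr_normc_diff_quot (t y : R) (z : R[i]) : t != 0 ->
  normc (t^-1%:C%C * (expi (t * y) * z - z) - iM y z) ^+ 2 <=
  5 * normc (iM y z) ^+ 2.
Proof.
move=> t0; rewrite sqr_normc_diff_quot normc_sqrE.
have H (w : R) : `|w| <= `|t * y| -> (t^-1 * w) ^+ 2 <= y ^+ 2.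
  move=> wy; rewrite -real_normK ?num_real// -[leRHS]real_normK ?num_real//.
  rewrite lerXn2r ?nnegrE// normrM normfV ler_pdivrMl ?normr_gt0//.
  by rewrite -normrM.
have := H _ (cos_le_norm (t * y)); have := H _ (sin_le_norm (t * y)).
set A := t^-1 * (_ - 1); set B := t^-1 * sin _ => B2 A2.
(* The constant: A^2 and B^2 are at most y^2, and (B - y)^2 <= 2B^2 + 2y^2. *)
have AB : A ^+ 2 + (B - y) ^+ 2 <= 5 * y ^+ 2.
  by have := sqr_ge0 (B + y); nra.
have := ler_wpM2r (addr_ge0 (sqr_ge0 (complex.Re z)) (sqr_ge0 (complex.Im z))) AB.
by case: z => a b; rewrite /iM /=; congr (_ <= _); ring.
Qed.

Definition dq_err x xi eta (t : R) (s : TR) : R :=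
  normc (diff_quot x xi t s - (eta s : R[i])).

Lemma measurable_dq_err x xi eta t : measurable_fun setT (dq_err x xi eta t).
Proof.
pose r := rep (scaleL0 t x) xi.
have := measurable_normc
  (measurable_funB
    (measurable_funM (measurable_cst t^-1)
      (measurable_funB (measurable_Re r) (measurable_Re xi))) (measurable_Re eta))
  (measurable_funB
    (measurable_funM (measurable_cst t^-1)
      (measurable_funB (measurable_Im r) (measurable_Im xi))) (measurable_Im eta)).
congr measurable_fun; apply/funext => s; rewrite /dq_err /diff_quot -/r /=.
case: (r s : R[i]) (xi s : R[i]) (eta s : R[i]) => [a b] [c d] [e f] /=.
congr (Num.sqrt (_ ^+ 2 + _ ^+ 2)); ring.
Qed.

Lemma dq_err_ae x xi eta t : {ae mu, forall s, dq_err x xi eta t s =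
  normc (t^-1%:C%C * (expi (t * x s) * (xi s : R[i]) - (xi s : R[i])) -
    (eta s : R[i]))}.
Proof.
have rep_ae : {ae mu, forall s, rep (scaleL0 t x) xi s =
    expi (scaleL0 t x s) * (xi s : R[i])} by exact: repr_pi_ae.
have scale_ae : {ae mu, forall s, scaleL0 t x s = t * x s} by exact: repr_pi_ae.
apply: filterS2 rep_ae scale_ae => s reps scales.
by rewrite /dq_err /diff_quot reps scales.
Qed.

(** The exceptional null set depends on t; along a sequence only countably many are united. *)
Lemma ae_eq_dq_err_sqr_cvg x xi eta (u : R^nat) :
  (forall n, u n != 0) -> u n @[n --> \oo] --> 0 ->
  {ae mu, forall s, dq_err x xi eta (u n) s ^+ 2 @[n --> \oo] -->
    normc (iM (x s) (xi s) - (eta s : R[i])) ^+ 2}.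
Proof.
move=> u0 cu.
have : {ae mu, forall s n, dq_err x xi eta (u n) s =
    normc ((u n)^-1%:C%C * (expi (u n * x s) * (xi s : R[i]) - (xi s : R[i])) -
      (eta s : R[i]))}.
  by apply/ae_foralln => n; exact: dq_err_ae.
apply: filterS => s Hs; under eq_fun do rewrite Hs.
exact: cvg_sqr_normc_diff_quot.
Qed.

Lemma powint2_sqr (f : TR -> R) : powint mu 2 f = (\int[mu]_s (f s ^+ 2)%:E)%E.
Proof.
by rewrite powintE; apply: eq_integral => s _; rewrite powR_mulrn// real_normK// num_real.
Qed.

Lemma L2_dist x xi eta t :
  'N[mu]_2%:E[(fun s => (normc (diff_quot x xi t s - (eta s : R[i])))%:E)]%E =
  (powint mu 2 (dq_err x xi eta t) `^ 2^-1)%E.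
Proof. by rewrite unlock powintE. Qed.

(** Fatou along t = 1/(n + 1): the squared errors have integrals tending to 0, so their pointwise
    limit |i x xi - eta|^2 vanishes almost everywhere. *)
Lemma is_drep_ae x xi eta : is_drep x xi eta ->
  {ae mu, forall s, eta s = iM (x s) (xi s)}.
Proof.
move=> [_ /fine_cvgP[Nfin /cvgr_dnbhsP cN]].
pose u n : R := n.+1%:R^-1.
have u0 n : u n != 0 by rewrite invr_eq0 pnatr_eq0.
have cu : u n @[n --> \oo] --> 0 by exact: cvg_harmonic.
have := cN u (conj u0 cu).
under eq_fun do rewrite /= L2_dist.
move=> {}cN.
have cI : powint mu 2 (dq_err x xi eta (u n)) @[n --> \oo] --> 0%E.
  apply/fine_cvgP; split.
    have uN : \forall n \near \oo, u n != 0 -> 'N[mu]_2%:E[(fun s =>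
        (normc (diff_quot x xi (u n) s - (eta s : R[i])))%:E)]%E \is a fin_num.
      exact: (cu _ Nfin).
    apply: filterS uN => n /(_ (u0 n)); rewrite L2_dist.
    rewrite !ge0_fin_numE ?powint_ge0 ?poweR_ge0//.
    by apply: lty_poweRy; rewrite invr_eq0.
  have := cvg_sqr cN; rewrite expr0n /=.
  under eq_fun do rewrite fine_poweR -powR_mulrn ?powR_ge0// -powRrM mulVf//
    powRr1 ?fine_ge0 ?powint_ge0//.
  exact.
pose h n s := (dq_err x xi eta (u n) s ^+ 2)%:E.
have mh n : measurable_fun setT (h n).
  by apply/measurable_EFinP/measurable_funX; exact: measurable_dq_err.
have h0 n s : (0 <= h n s)%E by rewrite lee_fin sqr_ge0.
have := fatou mu measurableT mh (fun n s _ => h0 n s).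
have -> : (fun n => \int[mu]_s h n s)%E =
    (fun n => powint mu 2 (dq_err x xi eta (u n))).
  by apply/funext => n; rewrite powint2_sqr.
rewrite (cvg_limn_einf_sup cI).1 => intle0.
have einf0 s : (0 <= limn_einf (h ^~ s))%E.
  rewrite limn_einf_lim; apply: lime_ge; first exact: is_cvg_einfs.
  by apply: nearW => n; apply: le_ereal_inf_tmp => _ [m _ <-].
(* Measurability of the lower limit comes from that of the upper limit by a change of sign. *)
have meinf : measurable_fun setT (fun s => limn_einf (h ^~ s)).
  rewrite (_ : (fun s => _) = (fun s => - limn_esup (fun n => - h n s))%E).
    apply: measurableT_comp => //.
    apply: (measurable_fun_limn_esup (f := fun n s => (- h n s)%E)) => n.
    exact: measurableT_comp.
  apply/funext => s; rewrite -limn_einfN; congr limn_einf.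
  by apply/funext => n; rewrite /comp oppeK.
have int0 : (\int[mu]_s `|limn_einf (h ^~ s)| = 0)%E.
  apply/eqP; rewrite eq_le integral_ge0// andbT; apply: le_trans intle0.
  apply: ge0_le_integral => //; first exact: measurableT_comp.
  by move=> s _; rewrite gee0_abs.
have /(ae_eq_integral_abs mu measurableT meinf) := int0.
have cae := ae_eq_dq_err_sqr_cvg x xi eta u0 cu.
apply: filterS2 cae => s cs /(_ I).
have /cvg_limn_einf_sup[-> _] : h ^~ s @ \oo -->
    (normc (iM (x s) (xi s) - (eta s : R[i])) ^+ 2)%:E.
  by apply: cvg_EFin; [exact: nearW|exact: cs].
move=> [] /eqP; rewrite sqrf_eq0 => /eqP /Normc.eq0_normc /eqP.
by rewrite subr_eq0 => /eqP.
Qed.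

Lemma normc_iM (y : R) (z : R[i]) : normc (iM y z) = `|y * normc z|.
Proof.
rewrite /iM Normc.normcM normrM; congr (_ * _).
  by rewrite /= expr0n /= add0r sqrtr_sqr.
by rewrite ger0_norm// normc_ge0.
Qed.

(** Dominated convergence along sequences: the squared error is at most 5 |eta|^2, which is
    integrable. *)
Lemma is_drep_iM x xi eta : L2C eta ->
  {ae mu, forall s, eta s = iM (x s) (xi s)} -> is_drep x xi eta.
Proof.
move=> L2eta etaE; split => //.
have eta2 : (powint mu 2 (modulus eta) < +oo)%E by apply/LC_powint.
have err_le t : t != 0 -> {ae mu, forall s,
    dq_err x xi eta t s ^+ 2 <= 5 * modulus eta s ^+ 2}.
  move=> t0; apply: filterS2 (dq_err_ae x xi eta t) etaE => s errs etas.
  by rewrite errs /modulus etas; exact: le_sqr_normc_diff_quot.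
have dom0 s : (0 <= (5 * modulus eta s ^+ 2)%:E)%E.
  by rewrite lee_fin mulr_ge0// sqr_ge0.
have int_dom : mu.-integrable setT (fun s => (5 * modulus eta s ^+ 2)%:E).
  apply/integrableP; split.
    apply/measurable_EFinP/measurable_funM => //; apply/measurable_funX.
    exact: measurable_modulus.
  under eq_integral do rewrite (gee0_abs (dom0 _)) EFinM.
  rewrite ge0_integralZl_EFin//; last 2 first.
  - by move=> s _; rewrite lee_fin sqr_ge0.
  - by apply/measurable_EFinP/measurable_funX; exact: measurable_modulus.
  by rewrite -powint2_sqr lte_mul_pinfty.
have err_fin t : t != 0 -> (powint mu 2 (dq_err x xi eta t) < +oo)%E.
  move=> t0; rewrite powint2_sqr.
  have /integrableP[mdom] := int_dom; apply: le_lt_trans.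
  apply: ae_ge0_le_integral => //.
  - by move=> s _; rewrite lee_fin sqr_ge0.
  - by apply/measurable_EFinP/measurable_funX; exact: measurable_dq_err.
  - exact: measurableT_comp.
  apply: filterS (err_le t t0) => s Hs _.
  by rewrite (gee0_abs (dom0 s)) lee_fin.
apply/fine_cvgP; split.
  apply: filterS (nbhs_dnbhs_neq (0 : R)) => t t0; rewrite L2_dist.
  by rewrite ge0_fin_numE ?poweR_ge0// poweR_lty// err_fin.
apply/cvgr_dnbhsP => u [u0 cu].
have cI : (\int[mu]_s (dq_err x xi eta (u n) s ^+ 2)%:E)%E @[n --> \oo] --> 0%E.
  have mh n : measurable_fun setT (fun s => (dq_err x xi eta (u n) s ^+ 2)%:E).
    by apply/measurable_EFinP/measurable_funX; exact: measurable_dq_err.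
  have [] := @dominated_convergence _ _ _ mu _ measurableT _ (cst 0%E)
    _ mh (measurable_cst _) _ int_dom _.
  - have := ae_eq_dq_err_sqr_cvg x xi eta u0 cu.
    apply: filterS2 etaE => s -> + _; rewrite subrr Normc.normc0 expr0n /=.
    by move=> cs; apply: cvg_EFin; [exact: nearW|exact: cs].
  - have : {ae mu, forall s n, dq_err x xi eta (u n) s ^+ 2 <= 5 * modulus eta s ^+ 2}.
      by apply/ae_foralln => n; exact: err_le.
    apply: filterS => s Hs n _.
    by rewrite gee0_abs ?lee_fin ?sqr_ge0.
  by move=> _ _; rewrite integral0.
have {cI} /fine_cvgP[_ cI] := cI.
under eq_fun => n.
  rewrite /= L2_dist fine_poweR powR12_sqrt ?fine_ge0 ?powint_ge0// powint2_sqr.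
  over.
rewrite -(sqrtr0 R); apply: (continuous_cvg _ (@sqrt_continuous R 0)) cI.
Qed.

End derivative.

(** * The domains as multiplier spaces *)

Section domains.
Variable R : realType.
Local Notation TR := (measurableTypeR R).
Local Notation TC := (measurableTypeC R).
Local Notation mu := (@leb01 R).
Local Notation L0R := {mfun_ mu, TR >-> TR}.
Local Notation L0C := {mfun_ mu, TR >-> TC}.
Implicit Types (x : L0R) (xi eta : L0C).

Lemma modulus_iM_ae x xi eta :
  {ae mu, forall s, eta s = iM (x s) (xi s)} ->
  {ae mu, forall s, `|x s * modulus xi s| = `|modulus eta s|}.
Proof.
by apply: filterS => s; rewrite {2}/modulus => ->; rewrite normc_iM normr_id.
Qed.

(** A derivative has modulus |x xi| almost everywhere; conversely the class of i x xi, obtained by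
    letting a constant angle act on x xi, is one. *)
Lemma D_P x xi : D_ x xi <-> L2C xi /\ L2C (mulL0 x xi).
Proof.
have mxxi : measurable_fun setT (x \* modulus xi)%R.
  by apply: measurable_funM; [exact: measurable_class|exact: measurable_modulus].
split=> [[L2xi [eta deta]]|[L2xi /L2C_mulL0 L2xxi]].
  split => //; apply/L2C_mulL0; have [/(LC_powint _ (ltr0n _ 2)) eta2 _] := deta.
  rewrite (eq_powint_ae (g := modulus eta))//; first exact: measurable_modulus.
  exact: modulus_iM_ae (is_drep_ae deta).
(* [expi (pi / 2)] is the imaginary unit. *)
pose u : L0R := (\pi_(L0R)%qT (cst (pi / 2 : R) : {mfun TR >-> TR})).
pose eta := rep u (mulL0 x xi).
have etaE : {ae mu, forall s, eta s = iM (x s) (xi s)}.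
  have u_ae : {ae mu, forall s, u s = pi / 2} by exact: repr_pi_ae.
  have eta_ae : {ae mu, forall s, eta s = expi (u s) * (mulL0 x xi s : R[i])}.
    exact: repr_pi_ae.
  apply: filterS3 u_ae eta_ae (mulL0_ae x xi) => s us -> ->.
  rewrite us /iM /expi cos_pihalf sin_pihalf.
  by case: (xi s : R[i]) => a b; apply/eqP; rewrite eq_complex /=; apply/andP;
    split; apply/eqP; ring.
split => //; exists eta; apply: is_drep_iM => //.
apply/(LC_powint _ (ltr0n _ 2)).
rewrite (eq_powint_ae (g := (x \* modulus xi)%R))//.
  exact: measurable_modulus.
by apply: filterS (modulus_iM_ae etaE) => s ->.
Qed.

Lemma is_drep_drep x xi : D_ x xi -> is_drep x xi (drep x xi).
Proof. by move=> [_ [eta deta]]; apply: xgetPex; exists eta. Qed.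

Lemma DgE p : (0 < p)%N -> @Dg R p = D_L p%:R.
Proof.
move=> p0; have pR : 0 < p%:R :> R by rewrite ltr0n.
apply/seteqP; split=> [xi Hxi|xi [L2xi Hxi] x px]; last by apply/D_P; split; auto.
split=> [|f pf]; last by have /D_P[] := Hxi f pf.
(* One concrete x in L^p, the constant 1, is needed to extract [L2C xi] from the intersection. *)
have [F F1] := exists_class (measurable_cst (1 : R)).
have /Hxi/D_P[]// : LR p%:R%:E F.
apply/(LR_ae pR _ F1); first exact: measurable_cst.
by rewrite powint_cst lte_mul_pinfty ?lee_fin ?powR_ge0// leb01_fin.
Qed.

(** Induction by [multiplier_factor]: (n + 2)/p = 1/p + (n + 1)/p, and the derivative has modulus
    |x| |xi|. *)
Lemma Dg_powE p n : (0 < p)%N -> @Dg_pow R p n.+1 = D_L (p%:R / n.+1%:R).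
Proof.
move=> p0; have pR : 0 < p%:R :> R by rewrite ltr0n.
elim: n => [|n IH]; first by rewrite divr1; exact: DgE.
pose s : R := p%:R; pose t : R := p%:R / n.+1%:R; pose r : R := p%:R / n.+2%:R.
have t0 : 0 < t by rewrite divr_gt0 ?ltr0n.
have r0 : 0 < r by rewrite divr_gt0 ?ltr0n.
have rst : r * (s + t) = s * t.
  have m0 : 0 < n.+1%:R :> R by rewrite ltr0n.
  rewrite /r /s /t -(natr1 n.+1); move: (n.+1%:R) m0 => m m0.
  by field; rewrite !gt_eqF// addr_gt0.
have mm := @measurable_modulus R.
have -> : @Dg_pow R p n.+2 = [set xi | D_L s xi /\
    forall x, LR s%:E x -> D_L t (drep x xi)].
  by rewrite -(DgE p0) -IH.
apply/seteqP; split=> [xi [Dxi Hxi]|xi /(D_LP _ r0) Hxi].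
  have Dgxi : Dg p xi by rewrite DgE.
  apply/(D_LP _ r0)/(multiplier_factor mu r0 pR t0 rst (mm xi)) => x mx sx.
  have [X Xx] := exists_class mx.
  have sX : LR s%:E X by apply/(LR_ae pR mx Xx).
  have /(D_LP _ t0) := Hxi X sX; apply: multiplier_ae => //.
    exact: measurable_funM.
  have dX := is_drep_ae (is_drep_drep (Dgxi X sX)).
  by apply: filterS2 Xx (modulus_iM_ae dX) => y /= <- ->.
(* Since r <= p and the measure is finite, L^p is contained in L^r. *)
have Dxi : D_L s xi.
  apply/(D_LP _ pR) => f mf sf; apply: Hxi => //.
  apply: powint_le_exp sf => //; last exact: leb01_fin.
  rewrite r0 /r ler_pdivrMr ?ltr0n// ler_peMr ?(ltW pR)//.
  by rewrite ler1n.
split=> // x sx; apply/(D_LP _ t0).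
have Dgxi : Dg p xi by rewrite DgE.
have dx := is_drep_ae (is_drep_drep (Dgxi x sx)).
apply: multiplier_ae (modulus_iM_ae dx) _ => //.
  by apply: measurable_funM => //; exact: measurable_class.
apply: ((multiplier_factor mu r0 pR t0 rst (mm xi)).1 Hxi).
  exact: measurable_class.
exact/(LR_powint _ pR).
Qed.

Lemma LC_oo xi :
  LC +oo%E xi <-> exists M : R, {ae mu, forall s, `|modulus xi s| <= M}.
Proof.
(* The norm at [+oo] is an essential supremum only when the total measure is positive, whence
   [leb01_setT]. *)
rewrite /LC /= /finite_norm unlock /Lnorm leb01_setT lte01.
split=> [|[M HM]].
  by move=> /(@ess_supr_bounded _ _ _ mu (fun s => `|modulus xi s|)).
apply: (@le_lt_trans _ _ M%:E); last exact: ltry.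
by apply/ess_supP; apply: filterS HM => s; rewrite /= lee_fin.
Qed.

Lemma modulus_eq0 xi :
  {ae mu, forall s, modulus xi s = 0} <-> xi = zeroC.
Proof.
have z0 : {ae mu, forall s, @zeroC R s = ((0 : R[i]) : TC)}.
  exact: repr_pi_ae.
split=> [xi0|->]; last first.
  by apply: filterS z0 => s; rewrite /modulus => ->; exact: Normc.normc0.
apply/class_eqP; apply: filterS2 xi0 z0 => s /Normc.eq0_normc xis ->.
exact: xis.
Qed.

End domains.

(** * The three cases, according to p/k compared with 2 *)

Theorem proposition10p4 (R : realType) (p k : nat)
    (p_gt0 : (0 < p)%N) (k_gt0 : (0 < k)%N) (le_kp : (k <= p)%N) :
  Dg_pow p k = D_L (p%:R / k%:R : R) /\
  D_L (p%:R / k%:R : R) =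
    (if (p%:R / 2 : R) < k%:R then [set zeroC]
     else if k%:R == (p%:R / 2 : R) then LC +oo%E
     else LC (2 * p%:R / (p%:R - 2 * k%:R))%:E).
Proof.
split; first by case: k k_gt0 {le_kp} => // n _; exact: Dg_powE.
have p0 : 0 < p%:R :> R by rewrite ltr0n.
have k0 : 0 < k%:R :> R by rewrite ltr0n.
set q : R := p%:R / k%:R.
have q0 : 0 < q by rewrite divr_gt0.
have mm := @measurable_modulus R.
have muoo := leb01_fin R.
(* In terms of q = p/k the cases come in the order q < 2, q > 2, q = 2. *)
case: ltgtP => [pk|pk|pk].
- apply/seteqP; split=> xi.
    move=> /(D_LP _ q0) /multiplier_lt2P H; apply/modulus_eq0/H => //.
    + by rewrite q0 /q ltr_pdivrMr// mulrC -ltr_pdivrMr.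
    + exact: leb01_diffuse.
  move=> /modulus_eq0 H; apply/(D_LP _ q0)/multiplier_lt2P => //.
  + by rewrite q0 /q ltr_pdivrMr// mulrC -ltr_pdivrMr.
  + exact: leb01_diffuse.
- have q2 : 2 < q by rewrite /q ltr_pdivlMr// mulrC -ltr_pdivlMr.
  have -> : 2 * p%:R / (p%:R - 2 * k%:R) = 2 * q / (q - 2).
    rewrite /q; field; rewrite mulNr !gt_eqF// subr_gt0.
    by rewrite mulrC -ltr_pdivlMr.
  have r0 : 0 < 2 * q / (q - 2) by apply: divr_gt0; [exact: mulr_gt0|rewrite subr_gt0].
  apply/seteqP; split=> xi.
    by move=> /(D_LP _ q0) /(multiplier_gt2P q2 (mm xi) muoo) /(LC_powint _ r0).
  by move=> /(LC_powint _ r0) ?; apply/(D_LP _ q0)/multiplier_gt2P.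
have -> : q = 2 by rewrite /q -pk; field; rewrite gt_eqF.
apply/seteqP; split=> xi.
  by move=> /(D_LP _ (ltr0n _ 2)) /(multiplier2P (mm xi) muoo) /LC_oo.
by move=> /LC_oo ?; apply/(D_LP _ (ltr0n _ 2))/multiplier2P.
Qed.
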